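(* Let $-\infty<a<b<\infty$, let $n\ge 3$ be an integer, let $f\in\mathcal C^n([a,b])$, and let $g\in L$ be any function with $g(E)\subseteq[a,b]$ and $f\circ g\in L$. If $f$ is $n$-convex and $n$ is odd, then $$\begin{aligned}&\sum_{k=2}^{n-1}f[a;\underbrace{b,\dots,b}_{k\text{ times}}]\,A\left[(g-a\mathbf 1)(g-b\mathbf 1)^{k-1}\right]\le LR(f,g,a,b,A)\\ &\le f[a,a;b]\,A[(g-a\mathbf 1)(g-b\mathbf 1)]+\sum_{k=2}^{n-2}f[a,a;\underbrace{b,\dots,b}_{k\text{ times}}]\,A\left[(g-a\mathbf 1)^2(g-b\mathbf 1)^{k-1}\right].\end{aligned}$$ The same inequalities also hold when $f$ is $n$-concave and $n$ is even. If $f$ is $n$-convex and $n$ is even, or if $f$ is $n$-concave and $n$ is odd, then both inequalities hold with the signs reversed.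
   Context: $E$ is a non-empty set; $L$ is a vector space (under pointwise operations) of functions $E\to\mathbb R$ containing the constant function $\mathbf 1$ (with $\mathbf 1(t)=1$ for all $t\in E$). $A\colon L\to\mathbb R$ is a positive linear functional (linear, and $A(h)\ge 0$ whenever $h\in L$ and $h(t)\ge0$ for all $t\in E$) with $A(\mathbf 1)=1$. Products and powers of functions are pointwise; empty sums are $0$. $$LR(f,g,a,b,A)=A(f\circ g)-\frac{b-A(g)}{b-a}f(a)-\frac{A(g)-a}{b-a}f(b).$$ Divided differences: for $f\in\mathcal C^n([a,b])$ and points $t_0\le t_1\le\dots\le t_k$ in $[a,b]$, $k\le n$, not necessarily distinct, $f[t_0,\dots,t_k]=f^{(k)}(t_0)/k!$ if $t_0=t_k$, and $f[t_0,\dots,t_k]=\dfrac{f[t_1,\dots,t_k]-f[t_0,\dots,t_{k-1}]}{t_k-t_0}$ otherwise. The value is taken to be independent of the order in which the points are listed; commas and semicolons both separate points. A function $f\colon[a,b]\to\mathbb R$ is $n$-convex if $f[t_0,\dots,t_n]\ge0$ for all choices of $n+1$ distinct points $t_0,\dots,t_n\in[a,b]$; it is $n$-concave if $-f$ is $n$-convex. *)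

(* Defs.v *)
From HB Require Import structures.
From mathcomp Require Import all_boot all_order all_algebra.
From mathcomp Require Import all_classical all_reals all_analysis.

Set Implicit Arguments.
Unset Strict Implicit.
Unset Printing Implicit Defensive.

Import Order.TTheory GRing.Theory Num.Theory.
Import numFieldNormedType.Exports.

Local Open Scope classical_set_scope.
Local Open Scope ring_scope.

(* A function [a, b] -> R is represented by a total function R -> R.  The
   derivatives below are taken within [a, b] (hence one-sided at a and b), so
   that their values on [a, b] only depend on the values of f on [a, b]. *)
Section derivatives_on_segment.
Variables (R : realType) (a b : R).

Definition diff_quotient (f : R -> R) (x y : R) : R := (f y - f x) / (y - x).

Definition derivable_on (f : R -> R) (x : R) : Prop :=
  cvg (diff_quotient f x @ within `[a, b] x^').

Definition derive_on (f : R -> R) (x : R) : R :=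
  lim (diff_quotient f x @ within `[a, b] x^').

Definition deriven_on (k : nat) (f : R -> R) : R -> R := iter k derive_on f.

Definition Cn_on (n : nat) (f : R -> R) : Prop :=
  (forall k, (k < n)%N ->
     forall x, x \in `[a, b] -> derivable_on (deriven_on k f) x) /\
  {within `[a, b], continuous (deriven_on n f)}.

(* t 0, ..., t k are the points t_0 <= ... <= t_k, repetitions being allowed *)
Fixpoint divdiff_sorted (f : R -> R) (k : nat) (t : nat -> R) : R :=
  if t 0%N == t k then deriven_on k f (t 0%N) / k`!%:R
  else if k is k'.+1 then
    (divdiff_sorted f k' (fun i => t i.+1) - divdiff_sorted f k' t)
      / (t k - t 0%N)
  else 0 (* unreachable: t 0 == t 0 *).

(* divided difference at the nonempty list of points s; sorting s makes the
   value independent of the order of the list *)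
Definition divdiff (f : R -> R) (s : seq R) : R :=
  divdiff_sorted f (size s).-1 (nth 0 (sort <=%R s)).

Definition nconvex (n : nat) (f : R -> R) : Prop :=
  forall s : seq R, size s = n.+1 -> uniq s -> {subset s <= `[a, b]} ->
    0 <= divdiff f s.

Definition nconcave (n : nat) (f : R -> R) : Prop := nconvex n (\- f).

End derivatives_on_segment.

Section positive_functionals.
Variables (R : realType) (E : Type).

Definition function_space (L : set (E -> R)) : Prop :=
  submod_closed [in L] /\ L (cst 1).

(* A functional on L is represented by a total map on E -> R, about which
   nothing is assumed outside L. *)
Definition positive_linear_on (L : set (E -> R)) (A : (E -> R) -> R) : Prop :=
  (forall (c : R) (u v : E -> R), L u -> L v ->
     A (c *: u + v) = c * A u + A v) /\
  (forall h : E -> R, L h -> (forall t, 0 <= h t) -> 0 <= A h).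

Definition LR (f : R -> R) (g : E -> R) (a b : R) (A : (E -> R) -> R) : R :=
  A (f \o g) - (b - A g) / (b - a) * f a - (A g - a) / (b - a) * f b.

End positive_functionals.

(* Main.v *)
Require Import Defs.
From HB Require Import structures.
From mathcomp Require Import all_boot all_order all_algebra.
From mathcomp Require Import all_classical all_reals all_analysis.
From mathcomp Require Import ring lra zify.

(* Let d = b - a, Q_k = f[a; b, .., b] and S_k = f[a, a; b, .., b] (k times b).
   Before A is applied, the lower and upper bounds are the Hermite interpolants
   of f at (a, b^(n-1)) and (a^2, b^(n-2)) in Newton form, evaluated at g(t).
   The identities Q_(k+1) d = f^(k)(b)/k! - Q_k and S_(k+1) d = Q_(k+1) - S_k
   turn these Newton forms into Taylor polynomials at b plus one term, which
   shows that they interpolate.  By Rolle, the errors at x are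
   f^(n)(y)/n! (x - a)(x - b)^(n-1) and f^(n)(y)/n! (x - a)^2 (x - b)^(n-2),
   whose signs are known once f^(n) >= 0.  The latter follows from n-convexity
   at equispaced points, where f[x, x + h, .., x + nh] = f^(n)(y)/n!. *)

Set Implicit Arguments.
Unset Strict Implicit.
Unset Printing Implicit Defensive.

Import Order.TTheory GRing.Theory Num.Theory.
Import numFieldNormedType.Exports.

Local Open Scope classical_set_scope.
Local Open Scope ring_scope.

(** * Derivatives within a segment; Rolle's theorem with a multiple zero at [b] *)

Section derivative_chains.
Variable R : realType.
Implicit Types (a b x : R) (n : nat) (F G : nat -> R -> R).

(* F k is the k-th derivative of F 0 inside [a, b]; at the endpoints only
   continuity is recorded. *)
Definition derivative_chain a b n F :=
  (forall k, (k < n)%N -> forall x, x \in `]a, b[%R ->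
     is_derive x 1 (F k) (F k.+1 x)) /\
  (forall k, (k <= n)%N -> {within `[a, b], continuous (F k)}).

(** Off [x], [f y] is the difference quotient times [y - x], plus [f x], and this tends to [f x]. *)
Lemma derivable_on_continuous a b f x :
  derivable_on a b f x -> f @ within `[a, b] (nbhs x) --> f x.
Proof.
move=> /cvg_ex [l fl].
have fx0 : f y @[y --> within `[a, b] x^'] --> f x.
  have -> : f x = l * (x - x) + f x by rewrite subrr mulr0 add0r.
  have H : diff_quotient f x y * (y - x) + f x @[y --> within `[a, b] x^']
      --> l * (x - x) + f x.
    apply: cvgD; last exact: cvg_cst.
    apply: cvgM; first exact: fl.
    apply: cvg_within_filter; apply: cvgB; last exact: cvg_cst.
    exact: nbhs_dnbhs.
  apply: cvg_trans H; apply: near_eq_cvg.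
  apply: cvg_within; apply: filterS (nbhs_dnbhs_neq x) => y yx.
  by rewrite /diff_quotient divfK ?subrK // subr_eq0.
(* The limit so far leaves out [y = x]; there [P (f x)] holds because [P] is a neighbourhood of
   [f x]. *)
move=> P Px.
have : \forall y \near x, y != x -> (y \in `[a, b]) -> P (f y) := fx0 P Px.
suff : (\forall y \near x, y != x -> (y \in `[a, b]) -> P (f y)) ->
  \forall y \near x, (y \in `[a, b]) -> P (f y) by [].
apply: filterS => y Hy yab; have [->|yx] := eqVneq y x.
  exact: nbhs_singleton.
exact: Hy.
Qed.

(** At an interior point the segment is a neighbourhood of [x], so restricting the limit to it
    changes nothing. *)
Lemma derivable_on_is_derive a b f x : x \in `]a, b[%R ->
  derivable_on a b f x -> is_derive x 1 f (derive_on a b f x).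
Proof.
move=> xab fx.
have xE : within `[a, b] x^' = x^'.
  rewrite eqEsubset; split=> U; last exact: cvg_within.
  apply: filterS2 (near_in_itvoo xab) => y yab + yx.
  by apply => //; exact: subset_itv_oo_cc.
rewrite /derive_on /derivable_on xE in fx *.
set l := lim _.
have fl : h^-1 *: ((f \o shift x) (h *: (1 : R)) - f x) @[h --> 0^'] --> l.
  have : diff_quotient f x (h + x) @[h --> 0^'] --> l.
    have sx : h + x @[h --> 0] --> x.
      rewrite -[X in _ --> X]add0r.
      by apply: cvgD; [exact: cvg_id|exact: cvg_cst].
    apply: cvg_comp fx => P xP.
    suff : \forall h \near (0 : R), h != 0 -> P (h + x) by exact: id.
    have : \forall h \near (0 : R), h + x != x -> P (h + x) := sx _ xP.
    by apply: filterS => h Ph h0; apply: Ph; rewrite -subr_eq0 addrK.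
  apply: cvg_trans; apply: near_eq_cvg; apply: nearW => h.
  by rewrite /diff_quotient /= addrK mulrC /GRing.scale /= mulr1.
split; first by apply/cvg_ex; exists l.
exact: (cvg_lim _ fl).
Qed.

(** Continuity is assumed at order [n] only; below, it follows from derivability within the segment,
    endpoints included. *)
Lemma Cn_on_derivative_chain a b n f :
  Cn_on a b n f -> derivative_chain a b n (fun k => deriven_on a b k f).
Proof.
move=> [df cf]; split=> k kn.
  move=> x xab; apply: derivable_on_is_derive => //; apply: df => //.
  exact: subset_itv_oo_cc.
move: kn; rewrite leq_eqVlt => /predU1P[->//|kn].
apply/subspace_continuousP => x xab; apply: derivable_on_continuous.
by apply: df => //; exact/mem_set.
Qed.

Lemma derivative_chainB a b n F G :
  derivative_chain a b n F -> derivative_chain a b n G ->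
  derivative_chain a b n (fun k x => F k x - G k x).
Proof.
move=> [dF cF] [dG cG]; split=> k kn.
  by move=> x xab; apply: is_deriveB; [exact: dF|exact: dG].
by move=> x; apply: continuousB; [exact: cF|exact: cG].
Qed.

Lemma derivative_chainN a b n F :
  derivative_chain a b n F -> derivative_chain a b n (fun k x => - F k x).
Proof.
move=> [dF cF]; split=> k kn.
  by move=> x xab; apply: is_deriveN; exact: dF.
by move=> x; apply: continuousN; exact: cF.
Qed.

Lemma derivative_chain_horner a b n (p : {poly R}) :
  derivative_chain a b n (fun k => horner p^`(k)).
Proof.
split=> k kn; first by move=> x _; rewrite derivnS; exact: is_derive_poly.
by apply: continuous_subspaceT; exact: continuous_horner.
Qed.

Lemma derivative_chainS a b n F : derivative_chain a b n.+1 F ->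
  derivative_chain a b n (fun k => F k.+1).
Proof. by move=> [dF cF]; split=> k kn; [exact: dF|exact: cF]. Qed.

Lemma derivative_chain_leq a b m n F : (m <= n)%N ->
  derivative_chain a b n F -> derivative_chain a b m F.
Proof.
move=> mn [dF cF]; split=> k km; first exact: dF (leq_trans km mn).
exact: cF (leq_trans km mn).
Qed.

Lemma derivative_chainW a b c d n F : a <= c -> d <= b ->
  derivative_chain a b n F -> derivative_chain c d n F.
Proof.
move=> ac db [dF cF]; split=> k kn.
  move=> x; rewrite in_itv /= => /andP[cx xd]; apply: dF => //.
  by rewrite in_itv /= (le_lt_trans ac cx) (lt_le_trans xd db).
apply: (@continuous_subspaceW _ _ _ `[a, b]); last exact: cF.
move=> x /=; rewrite !in_itv /= => /andP[cx xd].
by rewrite (le_trans ac cx) (le_trans xd db).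
Qed.

Lemma derivative_chain_MVT a b n F : a < b -> derivative_chain a b n.+1 F ->
  exists2 c, c \in `]a, b[%R & F 0%N b - F 0%N a = F 1%N c * (b - a).
Proof. by move=> ab [dF cF]; apply: MVT => //; [exact: dF|exact: cF]. Qed.

Lemma derivative_chain_Rolle a b n F c d : a <= c -> c < d -> d <= b ->
  derivative_chain a b n.+1 F -> F 0%N c = 0 -> F 0%N d = 0 ->
  exists2 x, c < x < d & F 1%N x = 0.
Proof.
move=> ac cd db /(derivative_chainW ac db) Fcd Fc Fd.
have [x] := derivative_chain_MVT cd Fcd; rewrite in_itv /= => xcd.
rewrite Fc Fd subrr => /esym/eqP.
by rewrite mulf_eq0 subr_eq0 (gt_eqF cd) orbF => /eqP Fx; exists x.
Qed.

(** The zeros [c], [d] and [b] give two zeros of [F 1] before [b], and the order of the zero at [b]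
    drops by one: the same situation with [n] decreased. *)
Lemma rolle_two_zeros a b n F c d : a <= c -> c < d -> d < b ->
  derivative_chain a b n.+1 F -> F 0%N c = 0 -> F 0%N d = 0 ->
  (forall j, (j < n)%N -> F j b = 0) ->
  exists2 x, a < x < b & F n.+1 x = 0.
Proof.
elim: n F c d => [|n IH] F c d ac cd db HF Fc Fd Fb.
  have [x xcd Fx] := derivative_chain_Rolle ac cd (ltW db) HF Fc Fd.
  by exists x => //; lra.
have [x xcd Fx] := derivative_chain_Rolle ac cd (ltW db) HF Fc Fd.
have [y ydb Fy] := derivative_chain_Rolle (le_trans ac (ltW cd)) db (lexx b)
  HF Fd (Fb 0%N isT).
apply: (IH (fun k => F k.+1) x y) => //; try lra.
- exact: derivative_chainS.
- by move=> j jn; exact: Fb.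
Qed.

(** The zeros [c < d < e < b] give three zeros of [F 1]. When no zero at [b] is assumed, [c], [d],
    [e] still give two, and one more Rolle step ends. *)
Lemma rolle_three_zeros a b n F c d e :
  a <= c -> c < d -> d < e -> e < b ->
  derivative_chain a b n.+2 F -> F 0%N c = 0 -> F 0%N d = 0 -> F 0%N e = 0 ->
  (forall j, (j < n)%N -> F j b = 0) ->
  exists2 x, a < x < b & F n.+2 x = 0.
Proof.
elim: n F c d e => [|n IH] F c d e ac cd de eb HF Fc Fd Fe Fb;
  have [x xcd Fx] :=
    derivative_chain_Rolle ac cd (ltW (lt_trans de eb)) HF Fc Fd;
  have [y yde Fy] :=
    derivative_chain_Rolle (le_trans ac (ltW cd)) de (ltW eb) HF Fd Fe.
  have := @rolle_two_zeros a b 0 (fun k => F k.+1) x y.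
  by apply => //; try lra; exact: derivative_chainS.
have ae : a <= e by lra.
have [z zeb Fz] := derivative_chain_Rolle ae eb (lexx b) HF Fe (Fb 0%N isT).
apply: (IH (fun k => F k.+1) x y z) => //; try lra.
- exact: derivative_chainS.
- by move=> j jn; exact: Fb.
Qed.

End derivative_chains.

(** * Forward differences and the sign of the n-th derivative of an n-convex function *)

Section forward_differences.
Variable R : realType.
Implicit Types (a b c h x : R) (n k : nat) (f : R -> R) (F : nat -> R -> R).

Definition forward_difference h f x := f (x + h) - f x.

Lemma eq_divdiff_sorted a b f k (t u : nat -> R) :
  (forall i, (i <= k)%N -> t i = u i) ->
  divdiff_sorted a b f k t = divdiff_sorted a b f k u.
Proof.
elim: k t u => [|k IH] t u tu /=; first by rewrite tu.
rewrite !tu //; case: ifP => // _; congr ((_ - _) / _); apply: IH => i ik.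
  exact: tu.
by apply: tu; exact: leqW.
Qed.

Lemma divdiff_sorted_cst a b f k (t : nat -> R) : t 0%N = t k ->
  divdiff_sorted a b f k t = deriven_on a b k f (t k) / k`!%:R.
Proof. by case: k => [|k] /= => [_|<-]; rewrite eqxx. Qed.

Lemma divdiff_sortedS a b f k (t : nat -> R) : t 0%N != t k.+1 ->
  divdiff_sorted a b f k.+1 t =
  (divdiff_sorted a b f k (fun i => t i.+1) - divdiff_sorted a b f k t) /
    (t k.+1 - t 0%N).
Proof. by move=> /negPf /= ->. Qed.

Lemma divdiff_sorted_equispaced a b f k c h : 0 < h ->
  divdiff_sorted a b f k (fun i => c + i%:R * h) =
  iter k (forward_difference h) f c / (k`!%:R * h ^+ k).
Proof.
move=> h0; elim: k c => [|k IH] c.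
  by rewrite /= eqxx mul0r addr0 /deriven_on /= fact0 expr0 !mulr1.
rewrite divdiff_sortedS; last first.
  rewrite mul0r addr0 -subr_eq0 opprD addNKr oppr_eq0.
  by rewrite mulf_neq0 ?pnatr_eq0 ?gt_eqF.
(* The tail of the sequence is the equispaced sequence starting at [c + h], to which the induction
   hypothesis applies. *)
under [X in (X - _) / _]eq_divdiff_sorted do
  rewrite mulrS mulrDl mul1r addrA.
rewrite !IH iterS /forward_difference factS exprS natrM.
have k0 : k.+1%:R != 0 :> R by rewrite pnatr_eq0.
have f0 : k`!%:R != 0 :> R by rewrite pnatr_eq0 -lt0n fact_gt0.
have h0' := lt0r_neq0 h0.
have hk0 : h ^+ k != 0 by rewrite expf_neq0.
rewrite [X in _ / X = _](_ : _ = k.+1%:R * h); last by rewrite mul0r; ring.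
move: k.+1%:R k0 k`!%:R f0 (h ^+ k) hk0 => q q0 r r0 p p0.
by field; rewrite q0 r0 p0 h0'.
Qed.

Lemma derivative_chain_shift a b h n F :
  derivative_chain (a + h) (b + h) n F ->
  derivative_chain a b n (fun k x => F k (x + h)).
Proof.
move=> [dF cF]; split=> k kn.
  move=> x; rewrite in_itv /= => /andP[ax xb].
  have xab : x + h \in `]a + h, b + h[ by rewrite in_itv /= !ltrD2r ax.
  have dFx := dF k kn _ xab.
  have dx : is_derive x 1 (fun y : R => y + h) 1.
    rewrite -[X in is_derive _ _ _ X]addr0.
    by apply: is_deriveD.
  by have := @is_derive1_comp _ (F k) (fun y : R => y + h) x _ _ dFx dx;
    rewrite mulr1.
apply/subspace_continuousP => x /= xab.
have xhab : x + h \in `[a + h, b + h].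
  by move: xab; rewrite !in_itv /= !lerD2r.
have := (subspace_continuousP _ _).1 (cF k kn) (x + h) xhab.
apply: cvg_comp => P xP.
have xxh : y + h @[y --> x] --> x + h.
  by apply: cvgD; [exact: cvg_id|exact: cvg_cst].
suff : \forall y \near x, (y \in `[a, b]) -> P (y + h) by exact: id.
have : \forall y \near x, (y + h \in `[a + h, b + h]) -> P (y + h) := xxh _ xP.
by apply: filterS => y Py yab; apply: Py; rewrite in_itv /= !lerD2r.
Qed.

(** By induction applied to the chain [F k (x + h) - F k x], only a first difference of [F n] is
    left, and the mean value theorem on [x, x + h] handles it. *)
Lemma forward_difference_MVT c h n F : 0 < h ->
  derivative_chain c (c + n%:R * h) n F ->
  exists2 x, c <= x <= c + n%:R * h &
    iter n (forward_difference h) (F 0%N) c = F n x * h ^+ n.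
Proof.
move=> h0; elim: n F => [|n IH] F HF.
  by exists c; rewrite ?mul0r ?addr0 ?lexx //= expr0 mulr1.
have nh : c + n.+1%:R * h = c + n%:R * h + h by ring.
have [x /andP[cx xc]] : exists2 x, c <= x <= c + n%:R * h &
    iter n (forward_difference h) (forward_difference h (F 0%N)) c =
    (F n (x + h) - F n x) * h ^+ n.
  apply: (IH (fun k x => F k (x + h) - F k x)); rewrite nh in HF.
  have HFn := derivative_chain_leq (leqnSn n) HF.
  apply: derivative_chainB; last first.
    by apply: derivative_chainW HFn; rewrite // lerDl ltW.
  apply: derivative_chain_shift; apply: derivative_chainW HFn => //.
  by rewrite lerDl ltW.
have xxh : x < x + h by rewrite ltrDl.
have Fx : derivative_chain x (x + h) n.+1 F.
  by apply: derivative_chainW HF; rewrite // nh lerD2r.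
have [y] : exists2 y, y \in `]x, x + h[ &
    F n (x + h) - F n x = F n.+1 y * (x + h - x).
  by apply: MVT => //; [apply: Fx.1|apply: Fx.2].
rewrite in_itv iterSr => /andP[xy yx] -> ->.
exists y; first by rewrite nh (le_trans cx (ltW xy)) (le_trans (ltW yx)) ?lerD2r.
rewrite exprS; ring.
Qed.

(** Were [F n] negative at [c], it would be negative near [c] by continuity, and [n.+1] equispaced
    points close to [c] would have a negative divided difference. *)
Lemma nconvex_derivative_ge0 a b n F : derivative_chain a b n F ->
  nconvex a b n (F 0%N) -> forall x, x \in `]a, b[%R -> 0 <= F n x.
Proof.
move=> HF cvxF c cab; rewrite leNgt; apply/negP => Fc.
have ab : a < b by move: cab; rewrite in_itv /= => /andP[]; exact: lt_trans.
have [Fcont _ _] := (continuous_within_itvP _ ab).1 (HF.2 n (leqnn n)).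
have : \forall x \near c, F n x < 0 /\ x \in `]a, b[.
  have Fneg : \forall x \near c, F n x < 0.
    exact: (cvgr_lt _ (Fcont _ cab)).
  by apply: filterS2 Fneg (near_in_itvoo cab) => x Fx xab.
move=> /nbhs_ballP [e /= e0 He].
(* The divisor [n.+1] gives n h < e, so that all the points lie in the ball. *)
pose h := e / n.+1%:R.
have n0 : 0 < n.+1%:R :> R by rewrite ltr0n.
have h0 : 0 < h by rewrite divr_gt0.
have Hx x : c <= x <= c + n%:R * h -> F n x < 0 /\ x \in `]a, b[.
  move=> /andP[cx xc]; apply: He; rewrite /ball /= distrC ger0_norm ?subr_ge0 //.
  rewrite ltrBlDl (le_lt_trans xc) // ltrD2l /h mulrA ltr_pdivrMr //.
  by rewrite mulrC ltr_pM2l // ltr_nat.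
have Hn : derivative_chain c (c + n%:R * h) n F.
  have /Hx[_] : c <= c + n%:R * h <= c + n%:R * h.
    by rewrite lexx lerDl mulr_ge0 // ltW.
  move: cab; rewrite !in_itv /= => /andP[/ltW ac _] /andP[_ /ltW cb].
  exact: derivative_chainW HF.
have [x /Hx[Fx _] FE] := forward_difference_MVT h0 Hn.
pose s := mkseq (fun i => c + i%:R * h) n.+1.
have lts : {homo (fun i => c + i%:R * h) : i j / (i < j)%N >-> i < j}.
  by move=> i j ij; rewrite ltrD2l ltr_pM2r // ltr_nat.
have s_sorted : sorted <%R s.
  by rewrite sorted_map; apply: sub_sorted (iota_ltn_sorted 0 n.+1) => i j /lts.
have s_ab : {subset s <= `[a, b]}.
  move=> y /mapP[i]; rewrite mem_iota /= add0n ltnS => lein ->.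
  have /Hx[_] : c <= c + i%:R * h <= c + n%:R * h.
    by rewrite lerDl lerD2l ler_pM2r // ler_nat lein mulr_ge0 // ltW.
  exact: subset_itv_oo_cc.
have := cvxF s (size_mkseq _ _) (lt_sorted_uniq s_sorted) s_ab.
rewrite /divdiff size_mkseq succnK sort_le_id; last exact: sub_sorted ltW _ s_sorted.
rewrite (@eq_divdiff_sorted _ _ _ _ _ (fun i => c + i%:R * h)); last first.
  by move=> i lein; rewrite nth_mkseq.
rewrite divdiff_sorted_equispaced // FE invfM mulrACA divff ?expf_neq0 ?lt0r_neq0 //.
rewrite mulr1 => Fx0.
move: Fx0; rewrite leNgt => /negP; apply.
by rewrite pmulr_llt0 // invr_gt0 ltr0n fact_gt0.
Qed.

End forward_differences.

(** * Recursions for divided differences whose points are all [a] or [b] *)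

Section two_point_divided_differences.
Variables (R : realType) (a b : R) (f : R -> R).
Hypothesis ab : a < b.

Let divdiffE k s : size s = k.+1 -> sorted <=%R s ->
  divdiff a b f s = divdiff_sorted a b f k (nth 0 s).
Proof. by move=> sk s_sorted; rewrite /divdiff sort_le_id // sk. Qed.

Let sorted_b k : sorted <=%R (nseq k b).
Proof. by case: k => //=; elim=> //= k ->; rewrite lexx. Qed.

Let sorted_ab k : sorted <=%R (a :: nseq k b).
Proof. by case: k => //= k; rewrite (ltW ab); exact: sorted_b k.+1. Qed.

Let sorted_aab k : sorted <=%R [:: a, a & nseq k b].
Proof. by have := sorted_ab k; rewrite /= lexx. Qed.

Let nth_b k i : (i <= k)%N -> nth 0 (nseq k.+1 b) i = b.
Proof. by move=> ik; rewrite nth_nseq ltnS ik. Qed.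

Lemma divdiff_nseq k :
  divdiff a b f (nseq k.+1 b) = deriven_on a b k f b / k`!%:R.
Proof.
by rewrite (divdiffE (size_nseq _ _)) // divdiff_sorted_cst !nth_nseq // ltnSn.
Qed.

Lemma divdiff1 x : divdiff a b f [:: x] = f x.
Proof. by rewrite /divdiff /= eqxx /deriven_on fact0 divr1. Qed.

(** For [k = 0] the shorter list is [[:: a]], so the recursion starts from [f a]. *)
Lemma divdiff_a_nseqS k : divdiff a b f (a :: nseq k.+1 b) =
  (divdiff a b f (nseq k.+1 b) - divdiff a b f (a :: nseq k b)) / (b - a).
Proof.
have sz j : size (a :: nseq j b) = j.+1 by rewrite /= size_nseq.
rewrite (divdiffE (sz _)) // (divdiffE (size_nseq _ _)) // (divdiffE (sz _)) //.
have tk : (a :: nseq k.+1 b)`_k.+1 = b by exact: nth_b.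
rewrite divdiff_sortedS; last by rewrite tk /= lt_eqF.
(* Only indices up to [k] count, and there the longer and the shorter list agree. *)
rewrite tk; congr ((_ - _) / _); apply: eq_divdiff_sorted => -[|i] // ik.
by rewrite /= nth_b 1?ltnW // nth_nseq ik.
Qed.

Lemma divdiff_aa_nseqS k : divdiff a b f [:: a, a & nseq k.+1 b] =
  (divdiff a b f (a :: nseq k.+1 b) - divdiff a b f [:: a, a & nseq k b]) /
    (b - a).
Proof.
have sz j : size (a :: nseq j b) = j.+1 by rewrite /= size_nseq.
have sz2 j : size [:: a, a & nseq j b] = j.+2 by rewrite /= size_nseq.
rewrite (divdiffE (sz2 k.+1)) // (divdiffE (sz _)) // (divdiffE (sz2 _)) //.
have tk : [:: a, a & nseq k.+1 b]`_k.+2 = b by exact: nth_b.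
rewrite divdiff_sortedS; last by rewrite tk /= lt_eqF.
rewrite tk; congr ((_ - _) / _); apply: eq_divdiff_sorted => -[|[|i]] // ik.
by rewrite /= nth_b 1?ltnW // nth_nseq (ik : (i < k)%N).
Qed.

Lemma divdiff_aa : divdiff a b f [:: a; a] = deriven_on a b 1 f a.
Proof.
by rewrite (@divdiffE 1) /= ?lexx // eqxx divr1.
Qed.

End two_point_divided_differences.

(** * Leading coefficients of Hermite interpolating polynomials *)

Section hermite_interpolation.
Variable R : realType.
Implicit Types (a b x : R) (n m : nat) (F : nat -> R -> R) (r : {poly R}).

Lemma derivn_comp_XsubC r b k :
  (r \Po ('X - b%:P))^`(k) = r^`(k) \Po ('X - b%:P).
Proof.
elim: k => // k IH; rewrite !derivnS IH deriv_comp derivB derivX derivC.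
by rewrite subr0 mulr1.
Qed.

Lemma horner_derivn0 r k : r^`(k).[0] = k`!%:R * r`_k.
Proof. by rewrite horner_coef0 coef_derivn addn0 ffactnn mulr_natl. Qed.

Lemma horner_derivn_size r n x : (size r <= n.+1)%N ->
  r^`(n).[x] = n`!%:R * r`_n.
Proof.
move=> rn; have /size1_polyC -> : (size r^`(n) <= 1)%N.
  apply/leq_sizeP => i i0; rewrite coef_derivn nth_default ?mul0rn //.
  by rewrite (leq_trans rn) // -addn1 leq_add2l.
by rewrite hornerC -horner_coef0 horner_derivn0.
Qed.

(** With [y - b] as the variable of [r], the coefficients of [r] are its Taylor coefficients at [b],
    and contact with [F] at [b] becomes a condition on them. *)
Lemma derivative_chain_subpoly a b n F r : derivative_chain a b n F ->
  derivative_chain a b n (fun k y => F k y - r^`(k).[y - b]).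
Proof.
move=> HF.
have := derivative_chainB HF (derivative_chain_horner a b n (r \Po ('X - b%:P))).
congr (derivative_chain _ _ _ _); apply/funext => k; apply/funext => y.
by rewrite derivn_comp_XsubC horner_comp !hornerE.
Qed.

(** The error vanishes at [a], at [x] and [n] times at [b], so its derivative of order n + 1 has a
    zero; that derivative of [r] is constant, by the degree bound. *)
Lemma hermite_leading_coef_simple a b x n F r :
  a < x < b -> derivative_chain a b n.+1 F -> (size r <= n.+2)%N ->
  F 0%N a = r.[a - b] -> F 0%N x = r.[x - b] ->
  (forall j, (j < n)%N -> F j b = j`!%:R * r`_j) ->
  exists2 y, a < y < b & F n.+1 y = n.+1`!%:R * r`_n.+1.
Proof.
move=> /andP[ax xb] HF rn Fa Fx Fb.
have [||j jn|y yab Fy] := rolle_two_zeros (lexx a) ax xb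
  (derivative_chain_subpoly r HF).
- by rewrite /= Fa subrr.
- by rewrite /= Fx subrr.
- by rewrite Fb // subrr horner_derivn0 subrr.
by exists y => //; apply/eqP; rewrite -subr_eq0 -(horner_derivn_size (y - b) rn) Fy.
Qed.

(** A first Rolle step turns the double zero of the error at [a] into simple zeros of its derivative
    at [a], in ]a, x[ and in ]x, b[, besides an [n]-fold one at [b]. *)
Lemma hermite_leading_coef_double a b x n F r :
  a < x < b -> derivative_chain a b n.+3 F -> (size r <= n.+4)%N ->
  F 0%N a = r.[a - b] -> F 1%N a = r^`().[a - b] -> F 0%N x = r.[x - b] ->
  (forall j, (j < n.+1)%N -> F j b = j`!%:R * r`_j) ->
  exists2 y, a < y < b & F n.+3 y = n.+3`!%:R * r`_n.+3.
Proof.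
move=> /andP[ax xb] HF rn Fa F1a Fx Fb.
have HG := derivative_chain_subpoly r HF.
have Gb j : (j < n.+1)%N -> F j b - r^`(j).[b - b] = 0.
  by move=> jn; rewrite Fb // subrr horner_derivn0 subrr.
have [||c /andP[ac cx] Gc] := derivative_chain_Rolle (lexx a) ax (ltW xb) HG.
- by rewrite /= Fa subrr.
- by rewrite /= Fx subrr.
have [||d /andP[xd db] Gd] := derivative_chain_Rolle (ltW ax) xb (lexx b) HG.
- by rewrite /= Fx subrr.
- by rewrite Gb.
have [|j jn|y yab Gy] := rolle_three_zeros (lexx a) ac (lt_trans cx xd) db
  (derivative_chainS HG) _ Gc Gd.
- by rewrite /= F1a subrr.
- exact: Gb.
by exists y => //; apply/eqP; rewrite -subr_eq0 -(horner_derivn_size (y - b) rn) Gy.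
Qed.

End hermite_interpolation.

(** * Newton forms with remainder *)

Section newton_remainder.

(** Here [y] stands for x - b, [d] for b - a, [q] for divided differences and [t] for Taylor
    coefficients or other divided differences. A general ring allows polynomials as well. *)
Lemma newton_taylor (A : comRingType) (y d : A) (t q : nat -> A) m :
  (forall k, q k.+1 * d = t k - q k) ->
  q 0%N + (y + d) * (\sum_(k < m) q k.+1 * y ^+ k) =
  \sum_(k < m) t k * y ^+ k + q m * y ^+ m.
Proof.
move=> qS; elim: m => [|m IH].
  by rewrite !big_ord0 mulr0 addr0 add0r mulr1.
rewrite !big_ord_recr /= mulrDr addrA IH exprS.
have -> : t m = q m.+1 * d + q m by rewrite qS subrK.
ring.
Qed.

Variable R : realType.
Implicit Types (a b x : R) (n : nat) (F : nat -> R -> R) (q s : nat -> R).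

(** For x inside, the interpolant plus a suitable multiple [c] of the nodal polynomial agrees with
    [F 0] at x too; [c] is its leading coefficient, hence a derivative over a factorial. *)
Lemma newton_remainder_simple a b n F q : a < b ->
  derivative_chain a b n.+2 F -> q 0%N = F 0%N a ->
  (forall k, q k.+1 * (b - a) = F k b / k`!%:R - q k) ->
  forall x, x \in `[a, b]%R -> exists2 y, a < y < b &
    F 0%N x - (q 0%N + (x - a) * \sum_(k < n.+1) q k.+1 * (x - b) ^+ k) =
    F n.+2 y / n.+2`!%:R * ((x - a) * (x - b) ^+ n.+1).
Proof.
move=> ab HF q0 qS x.
have fn0 k : k`!%:R != 0 :> R by rewrite pnatr_eq0 -lt0n fact_gt0.
have mid : a < (a + b) / 2 < b by lra.
(* At both endpoints the two sides vanish, so any [y] will do; the midpoint is taken. *)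
rewrite in_itv /= => /andP[]; rewrite le_eqVlt => /predU1P[<- _|ax].
  by exists ((a + b) / 2) => //; rewrite q0 subrr !mul0r mulr0 addr0 subrr.
rewrite le_eqVlt => /predU1P[->|xb].
  exists ((a + b) / 2) => //.
  rewrite subrr exprS mul0r !mulr0 big_ord_recl big1 => [|i _]; last first.
    by rewrite exprS mul0r mulr0.
  by rewrite expr0 addr0 mulr1 mulrC qS fact0 divr1 subrKC subrr.
pose p := q 0%N + (x - a) * \sum_(k < n.+1) q k.+1 * (x - b) ^+ k.
pose c := (F 0%N x - p) / ((x - a) * (x - b) ^+ n.+1).
have xa0 : x - a != 0 by rewrite subr_eq0 gt_eqF.
have xb0 : x - b != 0 by rewrite subr_eq0 lt_eqF.
have w0 : (x - a) * (x - b) ^+ n.+1 != 0 by rewrite mulf_neq0 // expf_neq0.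
pose r : {poly R} := (q 0%N)%:P + ('X + (b - a)%:P) *
  (\sum_(k < n.+1) (q k.+1)%:P * 'X^k) + c%:P * ('X + (b - a)%:P) * 'X^(n.+1).
have yba y : y - b + (b - a) = y - a by rewrite addrA subrK.
have rE y : r.[y] = q 0%N + (y + (b - a)) * (\sum_(k < n.+1) q k.+1 * y ^+ k) +
    c * (y + (b - a)) * y ^+ n.+1.
  rewrite !hornerE horner_sum; under eq_bigr do rewrite !hornerE.
  by [].
(* The first n + 1 coefficients are now visibly the Taylor coefficients of [F 0] at [b]. *)
have rT : r = \poly_(k < n.+1) (F k b / k`!%:R) +
    ((q n.+1)%:P + c%:P * ('X + (b - a)%:P)) * 'X^(n.+1).
  rewrite /r (newton_taylor _ (t := fun k => (F k b / k`!%:R)%:P)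
    (q := fun k => (q k)%:P)); last by move=> k; rewrite -polyCM qS polyCB.
  rewrite poly_def mulrDl addrA; congr (_ + _ + _).
  by apply: eq_bigr => k _; rewrite mul_polyC.
have r_coef j : r`_(j + n.+1) = (q n.+1)%:P`_j + c * ('X + (b - a)%:P)`_j.
  rewrite rT coefD coef_poly ltnNge leq_addl /= add0r coefMXn ltnNge leq_addl /=.
  by rewrite addnK coefD coefCM.
have [||||j jn|y yab Fy] := @hermite_leading_coef_simple _ a b x n.+1 F r _ HF.
- by rewrite ax.
- apply/leq_sizeP => j jn; rewrite -(subnK (ltnW (ltnW jn))) r_coef.
  have : (1 < j - n.+1)%N by lia.
  case: (j - n.+1)%N => [//|[//|k]] _.
  by rewrite coefD !coefC coefX /= !(addr0, mulr0).
- by rewrite rE yba subrr !(mul0r, mulr0) !addr0.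
- by rewrite rE yba -mulrA /c divfK // /p addrC subrK.
- by rewrite rT coefD coef_poly jn coefMXn jn addr0 mulrC divfK.
exists y => //; rewrite Fy.
have -> : r`_n.+2 = c.
  by rewrite (r_coef 1%N) coefD !coefC coefX /= addr0 add0r mulr1.
by rewrite [X in _ = X * _]mulrAC divff // mul1r /c divfK.
Qed.

Lemma newton_remainder_double a b n F q s : a < b ->
  derivative_chain a b n.+3 F -> q 0%N = F 0%N a ->
  (forall k, q k.+1 * (b - a) = F k b / k`!%:R - q k) ->
  s 0%N = F 1%N a ->
  (forall k, s k.+1 * (b - a) = q k.+1 - s k) ->
  forall x, x \in `[a, b]%R -> exists2 y, a < y < b &
    F 0%N x - (q 0%N + (x - a) *
      (s 0%N + (x - a) * \sum_(k < n.+1) s k.+1 * (x - b) ^+ k)) =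
    F n.+3 y / n.+3`!%:R * ((x - a) ^+ 2 * (x - b) ^+ n.+1).
Proof.
move=> ab HF q0 qS s0 sS x.
have fn0 k : k`!%:R != 0 :> R by rewrite pnatr_eq0 -lt0n fact_gt0.
have mid : a < (a + b) / 2 < b by lra.
rewrite in_itv /= => /andP[]; rewrite le_eqVlt => /predU1P[<- _|ax].
  exists ((a + b) / 2) => //.
  by rewrite q0 subrr expr0n /= !mul0r mulr0 addr0 subrr.
rewrite le_eqVlt => /predU1P[->|xb].
  exists ((a + b) / 2) => //.
  rewrite subrr [0 ^+ _]exprS mul0r !mulr0 big_ord_recl big1 => [|i _]; last first.
    by rewrite exprS mul0r mulr0.
  (* At x = b the recursions telescope: s_1 d = q_1 - s_0, then q_1 d = F(b) - q_0. *)
  rewrite expr0 addr0 mulr1 [_ * s 1%N]mulrC sS subrKC mulrC qS fact0 divr1.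
  by rewrite subrKC subrr.
pose p := q 0%N + (x - a) *
  (s 0%N + (x - a) * \sum_(k < n.+1) s k.+1 * (x - b) ^+ k).
pose c := (F 0%N x - p) / ((x - a) ^+ 2 * (x - b) ^+ n.+1).
have xa0 : x - a != 0 by rewrite subr_eq0 gt_eqF.
have xb0 : x - b != 0 by rewrite subr_eq0 lt_eqF.
have w0 : (x - a) ^+ 2 * (x - b) ^+ n.+1 != 0.
  by rewrite mulf_neq0 // expf_neq0.
pose u : {poly R} := \sum_(k < n.+1) (s k.+1)%:P * 'X^k + c%:P * 'X^(n.+1).
(* e stands for X - a, in the variable X - b. *)
pose e : {poly R} := 'X + (b - a)%:P.
pose r : {poly R} := (q 0%N)%:P + e * ((s 0%N)%:P + e * u).
have eE y : e.[y - b] = y - a.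
  by rewrite hornerD hornerX hornerC addrA subrK.
have uE y : u.[y] = \sum_(k < n.+1) s k.+1 * y ^+ k + c * y ^+ n.+1.
  rewrite !hornerE horner_sum; under eq_bigr do rewrite !hornerE.
  by [].
have rT : r = \poly_(k < n.+1) (F k b / k`!%:R) +
    ((q n.+1)%:P + e * ((s n.+1)%:P + c%:P * e)) * 'X^(n.+1).
  have -> : r = ((q 0%N)%:P + e * ((s 0%N)%:P +
      e * (\sum_(k < n.+1) (s k.+1)%:P * 'X^k))) + c%:P * e ^+ 2 * 'X^(n.+1).
    rewrite /r /u; ring.
  (* The inner bracket is expanded first, producing the coefficients [q k.+1]; a second expansion
     turns these into Taylor coefficients. *)
  rewrite /e (newton_taylor _ (t := fun k => (q k.+1)%:P)
    (q := fun k => (s k)%:P)); last by move=> k; rewrite -polyCM sS polyCB.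
  rewrite mulrDr addrA (newton_taylor _ (t := fun k => (F k b / k`!%:R)%:P)
    (q := fun k => (q k)%:P)); last by move=> k; rewrite -polyCM qS polyCB.
  rewrite poly_def; under [in RHS]eq_bigr do rewrite -mul_polyC.
  ring.
have r_coef j : r`_(j + n.+1) =
    (q n.+1)%:P`_j + (e * ((s n.+1)%:P + c%:P * e))`_j.
  rewrite rT coefD coef_poly ltnNge leq_addl /= add0r coefMXn ltnNge leq_addl /=.
  by rewrite addnK coefD.
have e_coef (v : {poly R}) j : (e * v)`_j.+1 = v`_j + (b - a) * v`_j.+1.
  by rewrite mulrDl coefD coefXM coefCM.
have [|||||j jn|y yab Fy] := @hermite_leading_coef_double _ a b x n F r _ HF.
- by rewrite ax.
- apply/leq_sizeP => j jn; rewrite -(subnK (ltnW (ltnW (ltnW jn)))) r_coef.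
  have : (2 < j - n.+1)%N by lia.
  case: (j - n.+1)%N => [//|[//|[//|k]]] _.
  by rewrite e_coef !coefD !coefCM !coefD !coefC !coefX /= !(addr0, mulr0).
- by rewrite !hornerD !hornerM eE subrr !mul0r hornerC addr0.
- have e' : e^`() = 1 by rewrite derivD derivX derivC addr0.
  rewrite derivD derivC add0r derivM e' mul1r !hornerD !hornerM eE hornerC.
  by rewrite subrr !mul0r !addr0.
- rewrite !hornerD !hornerM eE !hornerC !hornerD !hornerM eE hornerC uE.
  rewrite [RHS](_ : _ = p + c * ((x - a) ^+ 2 * (x - b) ^+ n.+1)).
    by rewrite /c divfK // addrC subrK.
  rewrite /p; ring.
- by rewrite rT coefD coef_poly jn coefMXn jn addr0 mulrC divfK.
exists y => //; rewrite Fy.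
have -> : r`_n.+3 = c.
  rewrite (r_coef 2%N) e_coef !coefD !coefCM !coefD !coefC !coefX /=.
  by rewrite !(addr0, mulr0, add0r, mulr1).
by rewrite [X in _ = X * _]mulrAC divff // mul1r /c divfK.
Qed.

End newton_remainder.

(** * Finite sums and inequalities under a positive linear functional *)

Section positive_functionals.
Variables (R : realType) (E : Type) (L : set (E -> R)) (A : (E -> R) -> R).
Hypotheses (L_space : function_space L) (A_pos : positive_linear_on L A).

Lemma function_space_lin c u v : L u -> L v -> L (c *: u + v).
Proof.
move=> Lu Lv; have [[_ lin] _] := L_space.
by have /set_mem := lin c u v (mem_set Lu) (mem_set Lv).
Qed.

(** Membership in [L] is carried through the same induction, since [A] is linear on [L] only. *)
Lemma positive_linear_sum (c : nat -> R) (u : nat -> E -> R) (r : seq nat) :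
  (forall k, k \in r -> L (u k)) ->
  L (fun t => \sum_(k <- r) c k * u k t) /\
  A (fun t => \sum_(k <- r) c k * u k t) = \sum_(k <- r) c k * A (u k).
Proof.
have [lin _] := A_pos; have [[/set_mem L0 _] _] := L_space.
elim: r => [|k r IH] Lr.
  rewrite big_nil; under eq_fun do rewrite big_nil.
  split=> //; have := lin (-1) 0 0 L0 L0.
  by rewrite scaler0 addr0 mulN1r addNr.
have [j jr|Lsum Asum] := IH; first by apply: Lr; rewrite inE jr orbT.
have Lk : L (u k) by apply: Lr; rewrite inE eqxx.
have -> : (fun t => \sum_(j <- k :: r) c j * u j t) =
    c k *: u k + (fun t => \sum_(j <- r) c j * u j t).
  by apply/funext => t; rewrite big_cons.
by split; [exact: function_space_lin|rewrite lin // Asum big_cons].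
Qed.

(** The factor [s] will be a sign, which covers the direct and the reversed inequalities at once. *)
Lemma positive_linear_le (s : R) u v : L u -> L v ->
  (forall t, 0 <= s * (u t - v t)) -> 0 <= s * (A u - A v).
Proof.
move=> Lu Lv uv; have [lin pos] := A_pos; have [[/set_mem L0 _] _] := L_space.
have A0 : A 0 = 0 by have := lin (-1) 0 0 L0 L0; rewrite scaler0 addr0 mulN1r addNr.
have Luv : L ((-1) *: v + u) by exact: function_space_lin.
have <- : A (s *: ((-1) *: v + u) + 0) = s * (A u - A v).
  by rewrite !lin // A0; ring.
apply: pos => [|t]; first exact: function_space_lin.
have -> : (s *: ((-1) *: v + u) + 0) t = s * (u t - v t).
  rewrite [LHS](_ : _ = s * (-1 * v t + u t) + 0) //; ring.
exact: uv.
Qed.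

End positive_functionals.

(** * Signs of the remainders, and the two inequalities *)

Lemma signed_remainder_ge0 (R : realType) (s v a b x : R) m p q : x \in `[a, b]%R ->
  0 <= s * (-1) ^+ m * v ->
  0 <= s * (v / q`!%:R * ((x - a) ^+ p * (x - b) ^+ m)).
Proof.
rewrite in_itv /= => /andP[ax xb] sv.
(* Writing (x - b)^m as (-1)^m (b - x)^m leaves only nonnegative factors besides the one in the
   hypothesis. *)
have -> : s * (v / q`!%:R * ((x - a) ^+ p * (x - b) ^+ m)) =
    s * (-1) ^+ m * v * ((x - a) ^+ p * (b - x) ^+ m / q`!%:R).
  by rewrite -[x - b]opprB [in LHS]exprNn; ring.
by rewrite mulr_ge0 // !mulr_ge0 ?invr_ge0 ?exprn_ge0 ?subr_ge0.
Qed.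

Theorem theorem2p3 (R : realType) (E : Type) (E_neq0 : [set: E] !=set0)
    (L : set (E -> R)) (A : (E -> R) -> R)
    (L_space : function_space L)
    (A_pos : positive_linear_on L A) (A_one : A (cst 1) = 1)
    (a b : R) (a_lt_b : a < b) (n : nat) (n_ge3 : (3 <= n)%N)
    (f : R -> R) (f_Cn : Cn_on a b n f)
    (g : E -> R) (g_L : L g) (g_ab : forall t, g t \in `[a, b]%R)
    (fg_L : L (f \o g))
    (* the functions to which A is applied in the conclusion belong to L *)
    (lower_L : forall k, (2 <= k <= n - 1)%N ->
       L (fun t => (g t - a) * (g t - b) ^+ k.-1))
    (upper_L : forall k, (2 <= k <= n - 2)%N ->
       L (fun t => (g t - a) ^+ 2 * (g t - b) ^+ k.-1)) :
  let lower := \sum_(2 <= k < n)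
    divdiff a b f (a :: nseq k b) *
      A (fun t => (g t - a) * (g t - b) ^+ k.-1) in
  let upper :=
    divdiff a b f [:: a; a; b] * A (fun t => (g t - a) * (g t - b)) +
    \sum_(2 <= k < n.-1)
      divdiff a b f [:: a, a & nseq k b] *
        A (fun t => (g t - a) ^+ 2 * (g t - b) ^+ k.-1) in
  ((nconvex a b n f /\ odd n) \/ (nconcave a b n f /\ ~~ odd n) ->
     lower <= LR f g a b A /\ LR f g a b A <= upper) /\
  ((nconvex a b n f /\ ~~ odd n) \/ (nconcave a b n f /\ odd n) ->
     lower >= LR f g a b A /\ LR f g a b A >= upper).
Proof.
move=> lower upper.
case: n n_ge3 f_Cn lower_L upper_L @lower @upper => [|[|[|m]]] // _ {}f_Cn.
move=> lower_L' upper_L' lower upper.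
have HF := Cn_on_derivative_chain f_Cn.
pose q k := divdiff a b f (a :: nseq k b).
pose s k := divdiff a b f [:: a, a & nseq k b].
have ba0 : b - a != 0 by rewrite subr_eq0 gt_eqF.
have q0 : q 0%N = f a := divdiff1 a b f a.
have qS k : q k.+1 * (b - a) = deriven_on a b k f b / k`!%:R - q k.
  by rewrite /q divdiff_a_nseqS // divfK // divdiff_nseq.
have s0 : s 0%N = deriven_on a b 1 f a by rewrite /s divdiff_aa.
have sS k : s k.+1 * (b - a) = q k.+1 - s k.
  by rewrite /s divdiff_aa_nseqS // divfK.
have [lin _] := A_pos; have [_ L1] := L_space.
(* [h] is f o g minus the chord of [f] over [a, b] at [g t], so that A h = LR. *)
pose h t := f (g t) - (q 0%N + q 1%N * (g t - a)).
have hE : h = (- q 1%N) *: g + ((q 1%N * a - q 0%N) *: cst 1 + f \o g).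
  by apply/funext => t; rewrite /h !fctE /= /GRing.scale /=; ring.
have Lh : L h by rewrite hE; do !apply: function_space_lin => //.
have Ah : A h = LR f g a b A.
  rewrite hE lin ?lin ?A_one //; last exact: function_space_lin.
  have q1 : q 1%N = (f b - f a) / (b - a).
    by apply: (canRL (mulfK ba0)); rewrite qS q0 fact0 divr1.
  by rewrite /LR q1 q0; field.
pose u k t := (g t - a) * (g t - b) ^+ k.-1.
have [k|Llow Alow] := positive_linear_sum L_space A_pos q
  (u := u) (r := index_iota 2 m.+3).
  by rewrite mem_index_iota => kn; apply: lower_L'; lia.
pose w k t := (g t - a) ^+ 2 * (g t - b) ^+ k.-1.
have [k|Lup0 Aup0] := positive_linear_sum L_space A_pos s
  (u := w) (r := index_iota 2 m.+2).
  by rewrite mem_index_iota => kn; apply: upper_L'; lia.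
(* The term f[a, a; b] (g - a)(g - b) has its function in [L] by [lower_L'] at k = 2. *)
pose up := s 1%N *: u 2%N + (fun t => \sum_(2 <= k < m.+2) s k * w k t).
have Lu2 : L (u 2%N) by exact: lower_L'.
have Lup : L up by exact: function_space_lin.
have Aup : A up = upper by rewrite lin // Aup0.
have recl (v : nat -> R) n x : \sum_(k < n.+1) v k.+1 * x ^+ k =
    v 1%N + \sum_(2 <= k < n.+2) v k * x ^+ k.-1.
  by rewrite big_ord_recl expr0 mulr1 2!big_add1 big_mkord.
have low_rem t : exists2 y, a < y < b &
    h t - \sum_(2 <= k < m.+3) q k * u k t =
    deriven_on a b m.+3 f y / m.+3`!%:R * ((g t - a) ^+ 1 * (g t - b) ^+ m.+2).
  have [y yab yE] :=
    @newton_remainder_simple _ a b m.+1 _ q a_lt_b HF q0 qS _ (g_ab t).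
  exists y => //; rewrite -[RHS]yE recl.
  under eq_bigr do rewrite mulrCA.
  by rewrite -big_distrr /h /=; ring.
have up_rem t : exists2 y, a < y < b &
    h t - up t =
    deriven_on a b m.+3 f y / m.+3`!%:R * ((g t - a) ^+ 2 * (g t - b) ^+ m.+1).
  have [y yab yE] :=
    @newton_remainder_double _ a b m _ q s a_lt_b HF q0 qS s0 sS _ (g_ab t).
  exists y => //; rewrite -[RHS]yE recl.
  have -> : up t = s 1%N * ((g t - a) * (g t - b)) +
      (g t - a) ^+ 2 * \sum_(2 <= k < m.+2) s k * (g t - b) ^+ k.-1.
    rewrite big_distrr; congr (_ + _); apply: eq_bigr => k _.
    by rewrite /w mulrCA.
  (* Thus s_0 (x - a) + s_1 (x - a)^2 = q_1 (x - a) + s_1 (x - a)(x - b): the chord appears in place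
     of the tangent at [a]. *)
  have -> : s 0%N = q 1%N - s 1%N * (b - a) by rewrite sS subKr.
  by rewrite /h /=; ring.
have main (e : R) :
    (forall y, y \in `]a, b[ -> 0 <= e * (-1) ^+ m.+2 * deriven_on a b m.+3 f y) ->
    0 <= e * (LR f g a b A - lower) /\ 0 <= e * (upper - LR f g a b A).
  move=> ey; rewrite -Ah -Aup /lower -Alow.
  split; apply: (positive_linear_le L_space A_pos) => // t.
    have [y yab ->] := low_rem t.
    by apply: signed_remainder_ge0 => //; apply: ey; rewrite in_itv.
  (* The exponent of g - b is one less than in the lower remainder; this sign change is offset by
     taking upper minus LR. *)
  rewrite -opprB mulrN -mulNr; have [y yab ->] := up_rem t.
  apply: signed_remainder_ge0 => //; have := ey y; rewrite in_itv => /(_ yab).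
  by rewrite exprS mulN1r mulrN !mulNr.
have sgnC (e : bool) : (-1) ^+ e * (-1) ^+ m.+2 = (-1) ^+ (e (+) odd m) :> R.
  by rewrite signr_addb signr_odd !exprS !mulN1r opprK.
have F_ge0 : nconvex a b m.+3 f ->
    forall y, y \in `]a, b[ -> 0 <= deriven_on a b m.+3 f y.
  exact: (nconvex_derivative_ge0 HF).
have F_le0 : nconcave a b m.+3 f ->
    forall y, y \in `]a, b[ -> deriven_on a b m.+3 f y <= 0.
  move=> fcv y yab; rewrite -oppr_ge0.
  exact: (nconvex_derivative_ge0 (derivative_chainN HF) fcv yab).
(* The sign (-1)^e must cancel that of (-1)^m times the n-th derivative; since n = m + 3, [m] and
   [n] have opposite parities. *)
have pos (e : bool) : (nconvex a b m.+3 f /\ e = odd m \/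
      nconcave a b m.+3 f /\ e = ~~ odd m) ->
    0 <= (-1) ^+ e * (LR f g a b A - lower) /\
    0 <= (-1) ^+ e * (upper - LR f g a b A).
  move=> fe; apply: main => y yab; rewrite sgnC.
  case: fe => -[fe ->].
    by rewrite addbb mul1r F_ge0.
  by rewrite addNb addbb mulN1r oppr_ge0 F_le0.
split=> fe.
  have [] := pos false; first by move: fe => /=; case: (odd m); intuition.
  by rewrite /= !mul1r !subr_ge0 => lowP upP; split.
have [] := pos true; first by move: fe => /=; case: (odd m); intuition.
by rewrite /= !mulN1r !oppr_ge0 !subr_le0 => lowP upP; split.
Qed.
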